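(* Let $G$ be a discrete group and let $\mathcal U$ be a relatively hyperbolic uniformity on a connected $G$-set $M$. Then the induced action of $G$ on the completion $\overline M$ of $(M,\mathcal U)$ is relatively hyperbolic in the sense of $\mathsf{RH}_{32}$; that is, $\overline M$ is a compact Hausdorff space on which $G$ acts by homeomorphisms properly on triples, cocompactly on pairs, and with at least two limit points.
   Context: $\mathsf S^2M$ is the set of unordered pairs (repetition allowed) of elements of $M$, and $\Delta^2M$ is the set of pairs $\{x,x\}$. For $\mathbf u\subset \mathsf S^2M$ with $\mathbf u\supset\Delta^2M$, $\mathbf u^2$ is the set of pairs $\{x,y\}$ such that $\{x,z\},\{z,y\}\in\mathbf u$ for some $z\in M$. A uniformity on $M$ is a filter $\mathcal U$ of subsets of $\mathsf S^2M$ containing $\Delta^2M$ such that for every $\mathbf u\in\mathcal U$ there is $\mathbf v\in\mathcal U$ with $\mathbf v^2\subset\mathbf u$. The completion $\overline M$ of $(M,\mathcal U)$ is the (Hausdorff) space of minimal Cauchy filters, with canonical map $\iota:M\to\overline M$; the $\mathcal U$-boundary is $\overline M\setminus\iota(M)$. A $G$-set $M$ is connected if there is a connected graph (no loops or multiple edges) with vertex set $M$ on which $G$ acts by automorphisms extending the action on $M$, with finitely many $G$-orbits of edges. A divider on $M$ is a set $\mathbf u\subset\mathsf S^2M$ containing $\Delta^2M$ for which there is a finite $F\subset G$ with $\bigl(\bigcap_{f\in F}f\mathbf u\bigr)^2\subset\mathbf u$. The filter generated by $\{g\mathbf u:g\in G\}$ is a uniformity, the uniformity generated by $\mathbf u$.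 A divider $\mathbf u$ is perspective if for every pair $\beta$ of points of $M$ the set $\{g\in G: g\beta\notin\mathbf u\}$ is finite. A uniformity $\mathcal U$ on a connected $G$-set $M$ is relatively hyperbolic (a relative hyperbolicity) if it is generated by a perspective divider and the $\mathcal U$-boundary has at least two points. For a compact Hausdorff $T$, $\Theta^nT$ is the space of $n$-element subsets of $T$. An action of a discrete group $G$ on $T$ is proper on triples if for every compact $K\subset\Theta^3T$ the set $\{g: gK\cap K\ne\varnothing\}$ is finite, and cocompact on pairs if there is a compact $K\subset\Theta^2T$ with $GK=\Theta^2T$. A point $a\in T$ is a limit point if there is $r\in T$ such that the cross $(\{r\}\times T)\cup(T\times\{a\})$ belongs to the closure of the set of graphs of the homeomorphisms $x\mapsto gx$, $g\in G$, in the space of closed subsets of $T\times T$ with the Vietoris topology. *)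

(* Defs.v *)
From HB Require Import structures.
From Stdlib Require Import Relation_Operators.
From mathcomp Require Import all_boot monoid.
From mathcomp Require Import all_classical topology.

Set Implicit Arguments.
Unset Strict Implicit.
Unset Printing Implicit Defensive.

Local Open Scope classical_set_scope.
Local Open Scope card_scope.

Section UnorderedPairs.

Definition S2 (M : Type) := {p : set M | exists x y, p = [set x; y]}.

Definition upair (M : Type) (x y : M) : S2 M :=
  exist _ [set x; y] (ex_intro _ x (ex_intro _ y erefl)).

Definition diag2 (M : Type) : set (S2 M) := range (fun x => upair x x).

Definition sqr2 (M : Type) (u : set (S2 M)) : set (S2 M) :=
  [set p | exists x y z, [/\ p = upair x y, u (upair x z) & u (upair z y)]].

Fact S2map_subproof (M N : Type) (f : M -> N) (p : S2 M) :
  exists x y, f @` sval p = [set x; y].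
Proof.
case: p => /= _ [x [y ->]]; exists (f x), (f y).
by rewrite image_setU !image_set1.
Qed.

Definition S2map (M N : Type) (f : M -> N) (p : S2 M) : S2 N :=
  exist _ (f @` sval p) (S2map_subproof f p).

Lemma S2_inj (M : Type) (p q : S2 M) : sval p = sval q -> p = q.
Proof.
case: p q => p Pp [q Pq] /= E; subst q.
by congr exist; apply: Prop_irrelevance.
Qed.

Lemma S2P (M : Type) (p : S2 M) : exists x y, p = upair x y.
Proof. by case: (svalP p) => x [y E]; exists x, y; apply: S2_inj. Qed.

Lemma upairC (M : Type) (x y : M) : upair x y = upair y x.
Proof. by apply: S2_inj; rewrite /= setUC. Qed.

Lemma S2map_upair (M N : Type) (f : M -> N) x y :
  S2map f (upair x y) = upair (f x) (f y).
Proof. by apply: S2_inj; rewrite /= image_setU !image_set1. Qed.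

Lemma sub_sqr2 (M : Type) (u : set (S2 M)) : @diag2 M `<=` u -> u `<=` sqr2 u.
Proof.
move=> du p up; have [x [y E]] := S2P p; subst p.
by exists x, y, y; split=> //; apply: du; exists y.
Qed.

End UnorderedPairs.

Record uniformity (M : Type) := Uniformity {
  unif :> set (S2 M) -> Prop;
  unif_filter : Filter unif;
  unif_diag : forall u, unif u -> @diag2 M `<=` u;
  unif_split : forall u, unif u -> exists2 v, unif v & sqr2 v `<=` u
}.
#[global] Existing Instance unif_filter.

Section Completion.
Variables (M : Type) (U : uniformity M).

Definition ucauchy (F : set_system M) :=
  ProperFilter F /\
  forall u, U u -> exists2 A, F A & forall x y, A x -> A y -> u (upair x y).

Definition min_ucauchy (F : set_system M) :=
  ucauchy F /\ forall F' : set_system M, ucauchy F' -> F' `<=` F -> F' = F.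

Definition completion := {F : set_system M | min_ucauchy F}.

HB.instance Definition _ := gen_eqMixin completion.
HB.instance Definition _ := gen_choiceMixin completion.

(* [completion_ent] is the filter on pairs of minimal Cauchy filters generated
   by the sets of pairs having a common [u]-small member, for [u] in [U]. *)
Definition small_common (u : set (S2 M)) : set (completion * completion) :=
  [set xy | exists A, [/\ sval xy.1 A, sval xy.2 A &
                          forall x y, A x -> A y -> u (upair x y)]].

Definition completion_ent : set_system (completion * completion) :=
  [set E | exists2 u, U u & small_common u `<=` E].

Lemma completion_inj (xi eta : completion) : sval xi = sval eta -> xi = eta.
Proof.
case: xi eta => F HF [F' HF'] /= E; subst F'.
by congr exist; apply: Prop_irrelevance.
Qed.

Lemma completion_proper (xi : completion) : ProperFilter (sval xi).
Proof. by case: xi => F [[]]. Qed.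

Fact completion_ent_filter : Filter completion_ent.
Proof.
split.
- by exists setT => //; exact: filterT.
- move=> E E' [u Uu uE] [v Uv vE]; exists (u `&` v); first exact: filterI.
  move=> xy [A [A1 A2 Auv]]; split.
    by apply: uE; exists A; split=> // x y Ax Ay; have [] := Auv x y Ax Ay.
  by apply: vE; exists A; split=> // x y Ax Ay; have [] := Auv x y Ax Ay.
- by move=> E E' EE' [u Uu uE]; exists u => //; exact: subset_trans EE'.
Qed.

Fact completion_ent_diag E : completion_ent E -> diagonal `<=` E.
Proof.
move=> [u Uu uE] [xi eta] /diagonalP <-; apply: uE.
by have [[_ /(_ u Uu)[A FA Au]] _] := svalP xi; exists A.
Qed.

Fact completion_ent_inv E : completion_ent E -> completion_ent (E^-1)%relation.
Proof.
move=> [u Uu uE]; exists u => // -[xi eta] [A [/= A1 A2 Au]].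
by apply: uE; exists A.
Qed.

Fact completion_ent_split E : completion_ent E ->
  exists2 E', completion_ent E' & (E' \; E' `<=` E)%relation.
Proof.
move=> [u Uu uE]; have [v Uv vu] := unif_split Uu.
exists (small_common v); first by exists v.
move=> [xi zeta] [eta /= [A [/= xA eA Av]] [B [/= eB zB Bv]]].
have Fx := completion_proper xi; have Fz := completion_proper zeta.
have Fe := completion_proper eta.
apply: uE; exists (A `|` B); split => /=.
- by apply: filterS xA => x; left.
- by apply: filterS zB => x; right.
have [z [Az Bz]] := filter_ex (filterI eA eB).
have vv := sub_sqr2 (unif_diag Uv).
move=> x y [Ax|Bx] [Ay|By]; apply: vu.
- by apply: vv; exact: Av.
- by exists x, y, z; split=> //; [exact: Av|exact: Bv].
- by exists x, y, z; split=> //; [exact: Bv|exact: Av].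
- by apply: vv; exact: Bv.
Qed.

HB.instance Definition _ := isUniform.Build completion
  completion_ent_filter completion_ent_diag completion_ent_inv
  completion_ent_split.

Definition point_filter (x : M) : set_system M :=
  [set A | exists2 u, U u & [set y | u (upair x y)] `<=` A].

Fact point_filterP x : min_ucauchy (point_filter x).
Proof.
have memx A : point_filter x A -> A x.
  by move=> [u Uu uA]; apply: uA; apply: (unif_diag Uu); exists x.
split; last first.
  move=> F' [PF' F'c] F'x; apply/seteqP; split=> // A [u Uu uA].
  have [B F'B Bu] := F'c u Uu; apply: (filterS _ F'B) => y By.
  by apply: uA; apply: Bu => //; apply: memx; apply: F'x.
split.
  split; first by move=> /memx.
  split.
  - by exists setT => //; exact: filterT.
  - move=> A B [u Uu uA] [v Uv vB]; exists (u `&` v); first exact: filterI.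
    by move=> y [uy vy]; split; [exact: uA|exact: vB].
  - by move=> A B AB [u Uu uA]; exists u => //; exact: subset_trans AB.
move=> u Uu; have [v Uv vu] := unif_split Uu.
exists [set y | v (upair x y)]; first by exists v.
move=> y z /= vy vz; apply: vu; exists y, z, x; split=> //.
by rewrite upairC.
Qed.

Definition iota_completion (x : M) : completion := exist _ _ (point_filterP x).

Definition boundary : set completion := ~` range iota_completion.

End Completion.

Section GSets.
Variable G : groupType.
Local Open Scope group_scope.

Definition is_action (X : Type) (act : G -> X -> X) :=
  (forall x, act 1 x = x) /\ (forall g h x, act (g * h) x = act g (act h x)).

Section Action.
Variables (M : Type) (act : G -> M -> M).

Definition orbit2 (p : S2 M) : set (S2 M) := range (fun g => S2map (act g) p).

(* A graph on the vertex set [M] is its set [E] of edges. *)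
Definition connected_gset :=
  exists E : set (S2 M),
    [/\ E `<=` ~` @diag2 M,
        forall g, S2map (act g) @` E = E,
        finite_set (orbit2 @` E) &
        forall x y,
          clos_refl_trans M (fun a b => E (upair a b)) x y].

Definition divider (u : set (S2 M)) :=
  @diag2 M `<=` u /\
  exists2 F : set G, finite_set F &
    sqr2 (\bigcap_(f in F) (S2map (act f) @` u)) `<=` u.

Definition perspective (u : set (S2 M)) :=
  forall b : S2 M, finite_set [set g | ~ u (S2map (act g) b)].

Definition generated (u : set (S2 M)) : set_system (S2 M) :=
  smallest (@Filter (S2 M)) (range (fun g => S2map (act g) @` u)).

Definition relatively_hyperbolic (U : uniformity M) :=
  (exists u, [/\ divider u, perspective u & unif U = generated u]) /\
  exists xi eta, [/\ boundary xi, boundary eta & xi <> eta :> completion U].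

Definition invariant (U : uniformity M) :=
  forall g u, U u -> U (S2map (act g) @` u).

Hypothesis actP : is_action act.

Lemma S2map_actK g : cancel (S2map (act g)) (S2map (act g^-1)).
Proof.
move=> p; have [x [y ->]] := S2P p.
by rewrite !S2map_upair -!actP.2 mulVg !actP.1.
Qed.

Lemma S2map_actVK g : cancel (S2map (act g^-1)) (S2map (act g)).
Proof.
move=> p; have [x [y ->]] := S2P p.
by rewrite !S2map_upair -!actP.2 mulgV !actP.1.
Qed.

Lemma S2map_act_image g (u : set (S2 M)) :
  S2map (act g) @` u = S2map (act g^-1) @^-1` u.
Proof.
apply/seteqP; split=> [_ [p up <-]|p up] /=; first by rewrite S2map_actK.
by exists (S2map (act g^-1) p) => //; rewrite S2map_actVK.
Qed.

Lemma relatively_hyperbolic_invariant (U : uniformity M) :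
  relatively_hyperbolic U -> invariant U.
Proof.
move=> [[u [_ _ EU]] _] g v.
rewrite EU => Gv D [DF Du]; rewrite S2map_act_image.
suff: fmap (S2map (act g^-1)) D v by [].
apply: Gv; split; first exact: fmap_filter.
move=> _ [h _ <-]; apply: Du => /=; exists (g * h) => //.
rewrite -S2map_act_image image_comp; congr (_ @` _); apply/funext => p /=.
by have [x [y ->]] := S2P p; rewrite !S2map_upair !actP.2.
Qed.

Section CompletionAction.
Variables (U : uniformity M) (invU : invariant U).

Lemma ucauchy_act g F : ucauchy U F -> ucauchy U (act g @ F).
Proof.
move=> [PF Fc]; split; first exact: fmap_proper_filter.
move=> u Uu; have [A FA Au] := Fc _ (invU g^-1 Uu).
exists (act g @` A).
  by apply: (@filterS _ F _ _ _ _ FA) => x Ax; exists x.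
move=> _ _ [x Ax <-] [y Ay <-]; have [p up pE] := Au x y Ax Ay.
by rewrite -S2map_upair -pE S2map_actVK.
Qed.

Lemma fmap_actVK g (F : set_system M) : fmap (act g) (fmap (act g^-1) F) = F.
Proof.
have E : act g \o act g^-1 = id.
  by apply/funext => x /=; rewrite -actP.2 mulgV actP.1.
by rewrite -[RHS]/(fmap id F) -E.
Qed.

Lemma fmap_actK g (F : set_system M) : fmap (act g^-1) (fmap (act g) F) = F.
Proof.
have E : act g^-1 \o act g = id.
  by apply/funext => x /=; rewrite -actP.2 mulVg actP.1.
by rewrite -[RHS]/(fmap id F) -E.
Qed.

Fact completion_act_subproof g (xi : completion U) :
  min_ucauchy U (act g @ sval xi).
Proof.
have [xc xmin] := svalP xi; split; first exact: ucauchy_act.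
move=> F' F'c F'xi; rewrite -(fmap_actVK g F').
congr (fmap _ _); apply: xmin; first exact: ucauchy_act.
rewrite -[sval xi](fmap_actK g) => A; exact: F'xi.
Qed.

Definition completion_act (g : G) (xi : completion U) : completion U :=
  exist _ (act g @ sval xi) (completion_act_subproof g xi).

End CompletionAction.
End Action.
End GSets.

Section Theta.
Variables (n : nat) (T : topologicalType).

Definition conf :=
  set_type [set x : prod_topology (fun _ : 'I_n => T) | injective x].

Definition Theta := {A : set T | A #= `I_n}.

Fact conf_set_subproof (x : conf) : range (val x : 'I_n -> T) #= `I_n.
Proof.
have xinj : injective (val x) by have /set_mem := valP x.
apply: card_eq_trans (card_esym card_II).
by apply: inj_card_eq => i j _ _; exact: xinj.
Qed.

Definition conf_set (x : conf) : Theta :=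
  exist (fun A : set T => A #= `I_n) _ (conf_set_subproof x).

HB.instance Definition _ := gen_eqMixin Theta.
HB.instance Definition _ := gen_choiceMixin Theta.

(* [Theta] carries the quotient topology of the space of injective [n]-tuples
   by the permutations of the indices. *)
Definition Theta_open : set_system Theta := [set V | open (conf_set @^-1` V)].

Fact Theta_openT : Theta_open setT.
Proof. exact: openT. Qed.

Fact Theta_openI : setI_closed Theta_open.
Proof. by move=> V W; exact: openI. Qed.

Fact Theta_open_bigU (I : Type) (f : I -> set Theta) :
  (forall i, Theta_open (f i)) -> Theta_open (\bigcup_i f i).
Proof.
move=> fo; rewrite /Theta_open /= preimage_bigcup.
by apply: bigcup_open => i _; exact: fo.
Qed.

HB.instance Definition _ := isOpenTopological.Build Theta
  Theta_openT Theta_openI Theta_open_bigU.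

Definition Theta_image (f : T -> T) (K : set Theta) : set Theta :=
  [set B | exists2 A, K A & sval B = f @` sval A].

End Theta.

Section Vietoris.
Variable X : topologicalType.

Definition closed_subset := {C : set X | closed C}.

HB.instance Definition _ := gen_eqMixin closed_subset.
HB.instance Definition _ := gen_choiceMixin closed_subset.

Definition vietoris_subbase : set_system closed_subset :=
  [set V | exists2 O : set X, open O &
     V = [set C | sval C `<=` O] \/ V = [set C | sval C `&` O !=set0]].

HB.instance Definition _ :=
  isSubBaseTopological.Build closed_subset vietoris_subbase id.

End Vietoris.

Section RH32.
Variables (G : groupType) (T : topologicalType) (rho : G -> T -> T).

(* The inverse of [rho g] is [rho g^-1], so that continuity of all [rho g]
   makes them homeomorphisms. *)
Definition acts_by_homeo := is_action rho /\ forall g, continuous (rho g).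

Definition proper_on_triples :=
  forall K : set (Theta 3 T), compact K ->
    finite_set [set g | Theta_image (rho g) K `&` K !=set0].

Definition cocompact_on_pairs :=
  exists2 K : set (Theta 2 T), compact K &
    \bigcup_g Theta_image (rho g) K = setT.

Definition graph (g : G) : set (T * T) := [set xy | xy.2 = rho g xy.1].

Definition cross (r a : T) : set (T * T) :=
  [set r] `*` setT `|` setT `*` [set a].

Definition limit_point (a : T) :=
  exists r, exists2 C : closed_subset (T * T)%type,
    sval C = cross r a &
    closure [set D : closed_subset (T * T)%type | exists g, sval D = graph g] C.

Definition RH32 :=
  [/\ compact [set: T] /\ hausdorff_space T,
      acts_by_homeo,
      proper_on_triples,
      cocompact_on_pairs &
      exists a b, [/\ limit_point a, limit_point b & a <> b]].

End RH32.

(* Main.v *)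
Require Import Defs.
From Stdlib Require Import Relation_Operators.
From mathcomp Require Import all_boot monoid.
From mathcomp Require Import all_classical topology.
From mathcomp Require Import finmap zify.

(** Let [d] be the path metric of an invariant connected graph on [M] with
    finitely many orbits of edges, and let [u] be a perspective divider that
    generates the uniformity. Apart from cocompactness on pairs, the proof rests
    on one property of geodesics, lemma [visibility]: for every [v] in the
    uniformity there is a finite set [V] of vertices such that, whenever
    [{p, x}] is not in [v], some [m] in [V] is strictly closer to [x] than [p]
    is.

    The reason is a form of Karlsson's lemma. The divider yields a sequence
    [level n] of sets of pairs with [level n.+1] squared inside [level n], each
    of them an intersection of finitely many translates of [u]. Perspectivity
    and the finiteness of the number of edge orbits show that an edge outside
    [level n] is at distance at most linear in [n] from a base point
    ([level_far]). Since the square of a level is in the preceding one, a chain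
    of exponentially many [level (n + k)] pairs has its ends in [level n], and
    exponential beats linear: a path that moves away from the base point at
    unit speed, starting far enough, has a pair of ends in [level 0]
    ([level_ray]). By the triangle inequality the [i]-th vertex of a geodesic
    from [p] is at distance at least [|i - d(o, p)|] from the base point [o].
    So a geodesic with large ends contains a large edge within a bounded number
    of steps of the index [d(o, p)]; and only finitely many edges are large.

    Applying [visibility] to a point of [V] closest to [x], both directly and
    through a group element [g], one gets [visibility_two_sided]: for all [g]
    and [x], either [x] is close to [g^-1 V] or [g x] is close to [g V]. For
    [g = 1] this is total boundedness, hence the compactness of the
    completion. By perspectivity both [g V] and [g^-1 V] are small except for
    finitely many [g], and then [g] maps the complement of a small set into a
    small set. This is the convergence property, from which one reads off
    properness on triples ([two_sided_proper]): among three points two lie on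
    the same side, so they or their images are close.

    Cocompactness on pairs holds because two different points of the completion
    are separated by a translate of [u] ([completion_separated]), so that some
    group element makes them [u]-distant. Finally every point [a] of the
    boundary is a limit point: [M] consists of finitely many orbits, so [a] is
    a limit of points [g m] with [m] fixed; along an ultrafilter of such [g],
    all [g x] tend to [a] and all [g^-1 x] to some [r], and the graphs of the
    [g] tend to the cross of [r] and [a] ([orbit_limit_point]). *)

Set Implicit Arguments.
Unset Strict Implicit.
Unset Printing Implicit Defensive.

Local Open Scope classical_set_scope.

(** * Finite sets and filters *)

Lemma finite_bounded (T : Type) (A : set T) (f : T -> nat) :
  finite_set A -> exists b, forall a, A a -> f a <= b.
Proof.
elim/Pchoice: T => T in A f *.
move=> /finite_seqP[s ->]; elim: s => [|a s [b bP]]; first by exists 0.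
exists (maxn (f a) b) => c /=; rewrite inE => /orP[/eqP->|cs].
  exact: leq_maxl.
by apply: leq_trans (bP c cs) (leq_maxr _ _).
Qed.

(** This provides representatives of finitely many orbits. *)
Lemma finite_image_lift (T T' : Type) (f : T -> T') (A : set T) :
    finite_set (f @` A) ->
  exists2 B, finite_set B & forall a, A a -> exists2 b, B b & f b = f a.
Proof.
move=> fA; have [->|/set0P[a0 _]] := eqVneq A set0.
  by exists set0 => // a [].
have rP y : exists x, (f @` A) y -> A x /\ f x = y.
  by have [[x Ax <-]|nfA] := pselect ((f @` A) y); [exists x|exists a0].
have [r rP'] := choice rP; exists (r @` (f @` A)); first exact: finite_image.
move=> a Aa; have fAa : (f @` A) (f a) by exists a.
by exists (r (f a)); [exists (f a) | exact: (rP' _ fAa).2].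
Qed.

(** The amount of levels to skip so that the exponential gain of composing
    levels exceeds the linear growth of distances. *)
Lemma exp2_beats_linear C : exists k, 0 < k /\ C * k < 2 ^ k.
Proof.
exists (4 * C.+1); split=> //.
have lt : C.+1 ^ 4 <= 2 ^ (4 * C.+1).
  by rewrite [4 * _]mulnC expnM leq_exp2r// ltnW// ltn_expl.
apply: leq_trans lt; rewrite !expnS expn0 muln1.
by have := leq_mul (leqnn C) (leqnn C); nia.
Qed.

Lemma filter_finite_bigcap (I T : Type) (F : set_system T) (D : set I)
    (f : I -> set T) : Filter F -> finite_set D -> (forall i, D i -> F (f i)) ->
  F (\bigcap_(i in D) f i).
Proof.
elim/Pchoice: I => I in D f *.
move=> FF /finite_seqP[s ->]; elim: s => [|i s IH] Ff.
  by apply: filterS filterT => x _ i; rewrite /= in_nil.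
apply: filterS (filterI (Ff i _) (IH _)) => [x [fi fs] j /=|/=|j js].
- by rewrite inE => /orP[/eqP->|] //; exact: fs.
- by rewrite mem_head.
- by apply: Ff; rewrite /= inE js orbT.
Qed.

Lemma ultra_finite_bigcup (I T : Type) (F : set_system T) (D : set I)
    (f : I -> set T) : UltraFilter F -> finite_set D ->
    F (\bigcup_(i in D) f i) -> exists2 i, D i & F (f i).
Proof.
move=> UF fD Ff; apply: contrapT => nex.
have : F (\bigcap_(i in D) ~` f i).
  apply: filter_finite_bigcap => // i Di.
  by have [Ffi|//] := in_ultra_setVsetC (f i) UF; case: nex; exists i.
move=> nF; have [x [[i Di fi] nf]] := filter_ex (filterI Ff nF).
exact: (nf i Di).
Qed.

(** * The path metric of a connected graph *)

Section GraphDistance.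
Variables (M : Type) (E : set (S2 M)).

Definition walk (n : nat) (x y : M) := exists p : nat -> M,
  [/\ p 0 = x, p n = y & forall i, i < n -> E (upair (p i) (p i.+1))].

Lemma walk0 x : walk 0 x x.
Proof. by exists (fun=> x). Qed.

Lemma walk1 x y : E (upair x y) -> walk 1 x y.
Proof.
by move=> Exy; exists (fun i => if i is 0 then x else y); split=> // -[].
Qed.

Lemma walk_cat n m x y z : walk n x y -> walk m y z -> walk (n + m) x z.
Proof.
move=> [p [p0 pn pE]] [q [q0 qm qE]].
exists (fun i => if i <= n then p i else q (i - n)); split=> [//||i iD].
  case: leqP => [|_]; last by rewrite addKn.
  case: m qm {qE} => [|m] qm; last by lia.
  by rewrite addn0 pn -qm q0.
have [lt|le|eq] := ltngtP i n; first exact: pE.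
  by rewrite subSn 1?ltnW//; apply: qE; lia.
by rewrite {1}eq pn -q0 eq subSnn; apply: qE; lia.
Qed.

Lemma walk_sym n x y : walk n x y -> walk n y x.
Proof.
move=> [p [p0 pn pE]]; exists (fun i => p (n - i)).
rewrite subn0 subnn; split=> // i iD; rewrite upairC.
by rewrite (_ : n - i = (n - i.+1).+1); [apply: pE; lia | lia].
Qed.

Lemma walk_sub (p : nat -> M) n i j :
    (forall i, i < n -> E (upair (p i) (p i.+1))) -> i <= j -> j <= n ->
  walk (j - i) (p i) (p j).
Proof.
move=> pE ij jn; exists (fun k => p (i + k)); split; rewrite ?addn0 ?subnKC//.
by move=> k kD; rewrite addnS; apply: pE; lia.
Qed.

(** The default value [0] of [xget] is never taken when the graph is
    connected. *)
Definition dist (x y : M) :=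
  xget 0 [set n | walk n x y /\ forall m, walk m x y -> n <= m].

Hypothesis conn : forall x y, clos_refl_trans M (fun a b => E (upair a b)) x y.

Lemma dist_min x y :
  walk (dist x y) x y /\ forall m, walk m x y -> dist x y <= m.
Proof.
have [n wn] : exists n, walk n x y.
  elim: (conn x y) => [a b /walk1|a|a b c _ [n wn] _ [m wm]]; first by exists 1.
    by exists 0; exact: walk0.
  by exists (n + m); exact: walk_cat wn wm.
apply: (@xgetPex _ 0 [set n | walk n x y /\ forall m, walk m x y -> n <= m]).
have ex : exists n, `[< walk n x y >] by exists n; apply/asboolP.
case: (ex_minnP ex) => k /asboolP wk kmin.
by exists k; split=> // m wm; apply: kmin; apply/asboolP.
Qed.

Lemma dist_walk n x y : walk n x y -> dist x y <= n.
Proof. exact: (dist_min x y).2. Qed.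

Lemma dist_sym x y : dist x y = dist y x.
Proof.
suff le a b : dist a b <= dist b a by apply/eqP; rewrite eqn_leq !le.
by apply/dist_walk/walk_sym; exact: (dist_min _ _).1.
Qed.

Lemma dist_triangle y x z : dist x z <= dist x y + dist y z.
Proof. by apply/dist_walk/(@walk_cat _ _ _ y); exact: (dist_min _ _).1. Qed.

(** A geodesic is continued by the constant path at its end, so that its
    vertices can be indexed by all natural numbers. *)
Lemma geodesic x y : exists p : nat -> M,
  [/\ p 0 = x, forall i, dist x y <= i -> p i = y,
      forall i, i < dist x y -> E (upair (p i) (p i.+1)),
      forall i, i <= dist x y -> dist x (p i) = i &
      forall i, i <= dist x y -> dist (p i) y <= dist x y - i].
Proof.
have [[p [p0 pn pE]] _] := dist_min x y.
set n := dist x y in pn pE *.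
have nE : n = dist x y by []; clearbody n; rewrite -?nE.
pose q i := p (minn i n).
have ple i : i <= n -> dist (p i) y <= n - i.
  by move=> le; apply/dist_walk; rewrite -pn; exact: walk_sub pE _ _.
have qp i : i <= n -> q i = p i by move=> le; rewrite /q; congr p; lia.
exists q; split.
- by rewrite qp.
- by move=> i le; rewrite -pn /q; congr p; lia.
- by move=> i lt; rewrite (qp i) 1?ltnW// (qp i.+1)//; exact: pE.
- move=> i le; rewrite qp//; apply/eqP; rewrite eqn_leq; apply/andP; split.
    by apply/dist_walk; rewrite -{1}p0 -{1}[i]subn0; exact: walk_sub pE _ _.
  by have := dist_triangle (p i) x y; have := ple i le; rewrite -/n; lia.
- by move=> i le; rewrite qp ?ple.
Qed.

End GraphDistance.

Section InvariantDistance.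
Variables (G : groupType) (M : Type) (act : G -> M -> M) (E : set (S2 M)).
Hypothesis actP : is_action act.
Hypothesis conn : forall x y, clos_refl_trans M (fun a b => E (upair a b)) x y.
Hypothesis Einv : forall g, S2map (act g) @` E = E.

Lemma dist_act g x y : dist E (act g x) (act g y) = dist E x y.
Proof.
suff le h a b : dist E (act h a) (act h b) <= dist E a b.
  apply/eqP; rewrite eqn_leq le /=.
  by have := le g^-1%g (act g x) (act g y); rewrite -!actP.2 mulVg !actP.1.
apply: dist_walk => //; have [p [pa pb pE]] := (dist_min conn a b).1.
exists (act h \o p); split; rewrite /= ?pa ?pb // => i lt.
rewrite -S2map_upair -(Einv h).
by exists (upair (p i) (p i.+1)) => //; exact: pE.
Qed.

End InvariantDistance.

(** * Uniformities on a set *)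

Section Uniformity.
Variables (M : Type) (U : uniformity M).

Lemma unif_refl u x : U u -> u (upair x x).
Proof. by move=> Uu; apply: (unif_diag Uu); exists x. Qed.

Lemma unif_split2 u : U u -> exists2 v, U v & forall a b c,
  v (upair a b) -> v (upair b c) -> u (upair a c).
Proof.
move=> Uu; have [v Uv vu] := unif_split Uu; exists v => // a b c ab bc.
by apply: vu; exists a, c, b.
Qed.

Lemma unif_split4 u : U u -> exists2 v, U v & forall a b c d e,
  v (upair a b) -> v (upair b c) -> v (upair c d) -> v (upair d e) ->
  u (upair a e).
Proof.
move=> Uu; have [v Uv vu] := unif_split2 Uu; have [w Uw wv] := unif_split2 Uv.
exists w => // a b c d e ab bc cd de.
by apply: (vu _ c); apply: wv; eassumption.
Qed.

Lemma unif_pow n u : U u -> exists2 w, U w &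
  forall q : nat -> M, (forall i, i < n -> w (upair (q i) (q i.+1))) ->
    u (upair (q 0) (q n)).
Proof.
elim: n u => [|n IH] u Uu; first by exists u => // q _; exact: unif_refl.
have [v Uv vu] := unif_split2 Uu; have [w Uw wv] := IH v Uv.
exists (w `&` v) => [|q qP]; first exact: filterI.
apply: (vu _ (q n)); last exact: (qP n (leqnn _)).2.
by apply: wv => i ilt; exact: (qP i (ltnW ilt)).1.
Qed.

End Uniformity.

(** * Divider levels and paths going to infinity *)

Section Divider.
Variables (G : groupType) (M : Type) (act : G -> M -> M).
Hypothesis actP : is_action act.
Local Open Scope group_scope.

Definition translates_cap (S : set G) (u : set (S2 M)) : set (S2 M) :=
  \bigcap_(s in S) (S2map (act s) @` u).

Lemma translates_capE S u x y : translates_cap S u (upair x y) <->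
  forall s, S s -> u (upair (act s^-1 x) (act s^-1 y)).
Proof.
split=> uS s Ss; have := uS s Ss; rewrite S2map_act_image//=.
  by rewrite S2map_upair.
by rewrite S2map_upair.
Qed.

Lemma generated_base u v : generated act u v ->
  exists2 H, finite_set H & translates_cap H u `<=` v.
Proof.
pose D := [set v | exists2 H, finite_set H & translates_cap H u `<=` v].
move=> /(_ D); apply.
split; first split.
- by exists set0.
- move=> v1 v2 [H1 fH1 s1] [H2 fH2 s2]; exists (H1 `|` H2).
    by rewrite finite_setU.
  by move=> p up; split; [apply: s1|apply: s2] => h Hh; apply: up; [left|right].
- by move=> v1 v2 v12 [H fH s1]; exists H => //; exact: subset_trans v12.
- move=> _ [g _ <-]; exists [set g]; first exact: finite_set1.
  by move=> p; apply.
Qed.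

Lemma generated_self u : generated act u u.
Proof.
move=> D [_]; apply; exists 1 => //.
rewrite (_ : S2map (act 1) = id) ?image_id//.
by apply/funext => q; have [x [y ->]] := S2P q; rewrite S2map_upair !actP.1.
Qed.

Section Levels.
Variables (u : set (S2 M)) (F H : set G).
Hypothesis u_diag : @diag2 M `<=` u.
Hypothesis u_div : sqr2 (translates_cap F u) `<=` u.

(** Starting the products of [n] elements of [F] with an arbitrary finite set
    [H], instead of the unit, makes [level 0] as small as any prescribed member
    of the generated uniformity. *)
Fixpoint words n : set G :=
  if n is n'.+1 then [set s * f | s in words n' & f in F] else H.

Definition level n := translates_cap (words n) u.

Lemma level_refl n x : level n (upair x x).
Proof. by apply/translates_capE => s _; apply: u_diag; exists (act s^-1 x). Qed.

(** This is the divider property of [u], translated by each word of length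
    [n]. *)
Lemma level_split n x y z :
  level n.+1 (upair x z) -> level n.+1 (upair z y) -> level n (upair x y).
Proof.
move=> /translates_capE xz /translates_capE zy.
apply/translates_capE => s sn; apply: u_div.
exists (act s^-1 x), (act s^-1 y), (act s^-1 z); split=> //.
all: apply/translates_capE => f Ff; rewrite -!actP.2 -invgM.
  by apply: xz; exists s => //; exists f.
by apply: zy; exists s => //; exists f.
Qed.

Local Open Scope nat_scope.

(** Halve the chain [k] times, gaining one level each time. *)
Lemma level_pow k n m (q : nat -> M) : m <= 2 ^ k ->
    (forall i, i < m -> level (n + k) (upair (q i) (q i.+1))) ->
  level n (upair (q 0) (q m)).
Proof.
elim: k n m q => [|k IH] n m q mk qP.
  case: m mk qP => [|[|m]] mk qP; [exact: level_refl| |by []].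
  by rewrite -[n]addn0; exact: qP.
set m1 := minn m (2 ^ k).
apply: (@level_split _ _ _ (q m1)).
  apply: IH => [|i im]; first by rewrite geq_minr.
  by rewrite addSnnS; apply: qP; rewrite /m1 in im; lia.
have -> : m = m1 + (m - m1) by lia.
rewrite -{1}[m1]addn0.
apply: (IH n.+1 (m - m1) (fun i => q (m1 + i))) => [|i im].
  by rewrite expnS in mk; lia.
by rewrite addSnnS [m1 + i.+1]addnS; apply: qP; lia.
Qed.

Variable E : set (S2 M).
Hypothesis Einv : forall g, S2map (act g) @` E = E.
Hypothesis conn : forall x y, clos_refl_trans M (fun a b => E (upair a b)) x y.
Hypotheses (fF : finite_set F) (fH : finite_set H).
Variables (V : set M).
(* The edges outside [u] have their ends in the finite set [V]. *)
Hypotheses (fV : finite_set V)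
  (VP : forall x y, E (upair x y) -> ~ u (upair x y) -> V x).

(** An edge outside [level n] is the translate, by a word of length [n], of one
    of the edges outside [u], which lie in a bounded region; and a word of
    length [n] moves [o] by an amount that is at most linear in [n]. *)
Lemma level_far (o : M) : exists C c, forall n x y,
  E (upair x y) -> C * n + c <= dist E o x -> level n (upair x y).
Proof.
have [C CP] := finite_bounded (fun f => dist E o (act f o)) fF.
have [h hP] := finite_bounded (fun f => dist E o (act f o)) fH.
have [r rP] := finite_bounded (dist E o) fV.
have wP n s : words n s -> dist E o (act s o) <= C * n + h.
  elim: n s => [|n IH] s; first by rewrite muln0; exact: hP.
  move=> [t tn [f Ff <-]]; rewrite actP.2.
  have := dist_triangle conn (act t o) o (act t (act f o)).
  by rewrite (dist_act actP)//; have := IH t tn; have := CP f Ff; lia.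
exists C, (h + r + 1) => n x y Exy far; apply/translates_capE => s sn.
apply: contrapT => nu.
have Vx : V (act s^-1 x).
  apply: VP nu; rewrite -S2map_upair -(Einv s^-1).
  by exists (upair x y).
have := dist_triangle conn (act s o) o x.
have := wP n s sn; have := rP _ Vx.
by rewrite -(dist_act actP conn Einv s o) -actP.2 mulgV actP.1; lia.
Qed.

(** Cut the path into blocks of [C * k] steps. The steps of the [a]-th block are
    in [level (a.+1 * k)], and so is, by induction, the pair of ends of the rest
    of the path; as there are at most [2 ^ k] pairs in this chain, its ends are
    in [level (a * k)]. Constant steps are allowed because a path that has
    reached its end stays there. *)
Lemma level_ray (o : M) : exists N, forall m (q : nat -> M),
    (forall i, i < m -> q i = q i.+1 \/
       E (upair (q i) (q i.+1)) /\ N + i <= dist E o (q i)) ->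
  level 0 (upair (q 0) (q m)).
Proof.
have [C0 [c far0]] := level_far o.
have [k [k0 kC0]] := exp2_beats_linear C0.+1.
have [C [C0' kC far]] : exists C, [/\ 0 < C, C * k < 2 ^ k & forall n x y,
    E (upair x y) -> C * n + c <= dist E o x -> level n (upair x y)].
  by exists C0.+1; split=> // n x y Exy le; apply: far0 => //; lia.
suff ray m a q : (forall i, i < m -> q i = q i.+1 \/
       E (upair (q i) (q i.+1)) /\ C * (a.+1 * k) + c + i <= dist E o (q i)) ->
    level (a * k) (upair (q 0) (q m)).
  by exists (C * (1 * k) + c) => m q qP; exact: (ray m 0).
have [n le] := ubnP m; elim: n => // n IH in m le a q *.
move=> qP; set m1 := minn m (C * k).
have stepP i : i < m1 -> level (a.+1 * k) (upair (q i) (q i.+1)).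
  move=> im; case: (qP i) => [|->|[Ei di]]; first by rewrite /m1 in im; lia.
    exact: level_refl.
  by apply: far => //; lia.
(* The chain of the first block, followed by one jump over the rest. *)
pose q' i := if i <= m1 then q i else q m.
have -> : q 0 = q' 0 by [].
have -> : q m = q' m1.+1 by rewrite /q' ltnn.
apply: (@level_pow k) => [|i im]; first by rewrite /m1; lia.
have -> : a * k + k = a.+1 * k by lia.
rewrite /q'; case: (ltnP i m1) => im1; first by rewrite ltnW//; exact: stepP.
have -> : i = m1 by lia.
rewrite leqnn.
have -> : m = m1 + (m - m1) by rewrite /m1; lia.
rewrite -{1}[m1]addn0.
case: (leqP m (C * k)) => mC.
  have -> : m - m1 = 0 by rewrite /m1; lia.
  exact: level_refl.
apply: (IH (m - m1) _ a.+1 (fun i => q (m1 + i))) => [|j jm].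
  by rewrite /m1; nia.
rewrite addnS; case: (qP (m1 + j)) => [|eq|[Ej dj]]; [lia|by left|right].
by split=> //; apply: leq_trans dj; rewrite /m1; nia.
Qed.

End Levels.
End Divider.

(** * Visibility *)

Section Visibility.
Variables (G : groupType) (M : Type) (act : G -> M -> M).
Hypothesis actP : is_action act.
Variables (U : uniformity M) (u : set (S2 M)).
Hypothesis (u_div : divider act u) (u_persp : perspective act u)
  (genU : unif U = generated act u).

(** Perspectivity passes from the divider to every member of the uniformity,
    which contains an intersection of finitely many translates. *)
Lemma unif_perspective v x y : U v ->
  finite_set [set g | ~ v (upair (act g x) (act g y))].
Proof.
rewrite genU => /generated_base[H fH Hv].
apply: (@sub_finite_set _ _ (\bigcup_(h in H)
    ((fun g => h * g)%g @` [set g | ~ u (S2map (act g) (upair x y))]))).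
  move=> g /= nv; apply: contrapT => nex; apply: nv; apply: Hv.
  apply/translates_capE => // h Hh; apply: contrapT => nu.
  apply: nex; exists h => //.
  by exists (h^-1 * g)%g; rewrite ?mulVKg// ?mulKVg//= S2map_upair !actP.2.
by apply: bigcup_finite => // h _; apply: finite_image; exact: u_persp.
Qed.

Variable E : set (S2 M).
Hypothesis Eact : forall g, S2map (act g) @` E = E.
Hypothesis Efin : finite_set (orbit2 act @` E).
Hypothesis conn : forall x y, clos_refl_trans M (fun a b => E (upair a b)) x y.

Lemma edge_orbits : exists2 B, finite_set B &
  forall p, E p -> exists2 b, B b & exists g, p = S2map (act g) b.
Proof.
have [B fB BP] := finite_image_lift Efin.
exists B => // p Ep; have [b Bb eq] := BP p Ep; exists b => //.
have : orbit2 act b p.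
  rewrite eq; exists 1%g => //.
  by have [x [y ->]] := S2P p; rewrite S2map_upair !actP.1.
by move=> [g _ <-]; exists g.
Qed.

Lemma finite_upair (p : S2 M) : finite_set (sval p).
Proof. by have [x [y ->]] := S2P p; exact: finite_set2. Qed.

(** There are finitely many edge orbits, and perspectivity leaves finitely many
    large edges in each of them. *)
Lemma large_edges v : U v -> exists2 V, finite_set V &
  forall x y, E (upair x y) -> ~ v (upair x y) -> V x /\ V y.
Proof.
move=> Uv; have [B fB BP] := edge_orbits.
exists (\bigcup_(b in B) \bigcup_(g in [set g | ~ v (S2map (act g) b)])
          sval (S2map (act g) b)).
  apply: bigcup_finite => // b _; apply: bigcup_finite => [|g _].
    have [x [y ->]] := S2P b.
    rewrite (_ : [set g | _] = [set g | ~ v (upair (act g x) (act g y))]).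
      exact: unif_perspective.
    by apply/funext => g /=; rewrite S2map_upair.
  exact: finite_upair.
move=> x y Exy nv; have [b Bb [g eq]] := BP _ Exy.
have inV z : sval (upair x y) z -> (\bigcup_(b in B)
    \bigcup_(g in [set g | ~ v (S2map (act g) b)]) sval (S2map (act g) b)) z.
  by rewrite eq in nv * => xyz; exists b => //; exists g.
by split; apply: inV; [left|right].
Qed.

Lemma vertex_orbits (a b : M) : a <> b -> exists2 V, finite_set V &
  forall x, exists2 m, V m & exists g, x = act g m.
Proof.
move=> ab; have [B fB BP] := edge_orbits.
exists (\bigcup_(b in B) sval b).
  by apply: bigcup_finite => // p _; exact: finite_upair.
move=> x; have [y xy] : exists y, x <> y.
  by have [->|] := pselect (x = a); [exists b | exists a].
have [[p [px py pE]] _] := dist_min conn x y.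
have d0 : 0 < dist E x y.
  by rewrite lt0n; apply/eqP => d0; apply: xy; rewrite -px -py d0.
have [c Bc [g eq]] := BP _ (pE 0 d0).
have : sval (S2map (act g) c) x by rewrite -eq px; left.
by move=> [m cm <-]; exists m; [exists c | exists g].
Qed.

(** The set [V] consists of [o] and of the ends of the edges that are not
    [w]-small, for [w] much finer than [v]. If a geodesic from [p] to [x]
    contains such an edge, the far end of this edge is the required vertex.
    Otherwise all edges are [w]-small. With [i0 = d(o, p)], the triangle
    inequality puts the [i]-th vertex at distance at least [|i - i0|] from [o],
    so [level_ray] applies to the two parts of the geodesic that start [N] steps
    before and after [i0], and the [2 * N] steps in between are controlled by
    the choice of [w]. *)
Lemma visibility v (o : M) : U v -> exists2 V, finite_set V & V o /\
  forall p x, ~ v (upair p x) -> exists2 m, V m & dist E m x < dist E p x.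
Proof.
move=> Uv; have [v' Uv' v'v] := unif_split4 Uv.
have u_diag := u_div.1; have [F fF u_sqr] := u_div.2.
have Uu : U u by rewrite genU; exact: generated_self.
have [V0 fV0 V0P] := large_edges Uu.
have [H fH Hv'] : exists2 H, finite_set H & translates_cap act H u `<=` v'.
  by apply: generated_base => //; rewrite -genU.
have [N NP] := level_ray actP u_diag u_sqr Eact conn fF fH fV0
  (fun x y Ex nu => (V0P x y Ex nu).1) o.
have [w Uw wv'] := unif_pow (2 * N) Uv'.
have [V fV VP] := large_edges Uw.
exists (V `|` [set o]); first by rewrite finite_setU; split=> //; exact: finite_set1.
split; first by right.
move=> p x nv; apply: contrapT => nm; apply: nv.
have [q [q0 qL qE qd qx]] := geodesic conn p x.
set L := dist E p x in qL qE qd qx nm.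
have qw i : w (upair (q i) (q i.+1)).
  have [iL|iL] := ltnP i L; last first.
    by rewrite !qL ?(leqW iL)//; exact: (unif_refl x Uw).
  apply: contrapT => nw; apply: nm; exists (q i.+1).
    by left; exact: (VP _ _ (qE i iL) nw).2.
  by apply: leq_ltn_trans (qx i.+1 iL) _; lia.
pose i0 := dist E o p; pose a := i0 - N; pose b := a + 2 * N.
have far i : i <= L -> i0 <= dist E o (q i) + i /\ i <= dist E o (q i) + i0.
  move=> iL; have := qd i iL.
  have := dist_triangle conn (q i) o p; have := dist_triangle conn o p (q i).
  by rewrite (dist_sym conn p o) (dist_sym conn (q i) p) /i0; lia.
have left_tail : v' (upair (q a) p).
  apply: Hv'; rewrite -q0 -[a]subn0 -{2}(subnn a).
  apply: (NP a (fun i => q (a - i))) => i ia.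
  have [iL|iL] := ltnP L (a - i); first by left; rewrite !qL//; lia.
  right; split; last by have := far _ iL; rewrite /a in ia *; lia.
  by rewrite upairC (_ : a - i = (a - i.+1).+1); [apply: qE|]; lia.
have right_tail : v' (upair (q b) x).
  have -> : x = q (b + L) by rewrite qL//; lia.
  apply: Hv'; rewrite -{1}[b]addn0; apply: (NP L (fun i => q (b + i))) => i iL.
  have [bL|bL] := leqP L (b + i); first by left; rewrite !qL//; lia.
  right; rewrite addnS; split; first exact: qE.
  by have := far _ (ltnW bL); rewrite /b /a; lia.
have middle : v' (upair (q a) (q b)).
  by rewrite -[a]addn0; apply: (wv' (fun i => q (a + i))) => i _; rewrite addnS.
by apply: v'v (unif_refl p Uv') _ middle right_tail; rewrite upairC.
Qed.

(** Let [m] be a point of [V] closest to [x]. If [{g m, g x}] is large, some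
    [m1] in [V] has [d(g^-1 m1, x) < d(m, x)]. If [{g^-1 m1, x}] is large too,
    some [m2] in [V] is closer still to [x], which contradicts the choice of
    [m]. *)
Lemma visibility_two_sided v (o : M) : U v -> exists2 V, finite_set V &
  forall g x, exists2 m, V m &
    v (upair (act g^-1%g m) x) \/ v (upair (act g m) (act g x)).
Proof.
move=> Uv; have [V fV [Vo VP]] := visibility o Uv; exists V => // g x.
have [m [Vm mmin]] :
    exists m, V m /\ forall m', V m' -> dist E m x <= dist E m' x.
  have ex : exists n, `[< exists2 m, V m & dist E m x = n >].
    by exists (dist E o x); apply/asboolP; exists o.
  case: (ex_minnP ex) => n /asboolP[m Vm <-] nmin; exists m; split=> // m' Vm'.
  by apply: nmin; apply/asboolP; exists m'.
apply: contrapT => nex.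
have [|m1 Vm1] := VP (act g m) (act g x).
  by move=> vm; apply: nex; exists m => //; right.
rewrite (dist_act actP)// => lt1.
have [|m2 Vm2] := VP (act g^-1%g m1) x.
  by move=> vm; apply: nex; exists m1 => //; left.
rewrite -(dist_act actP conn Eact g (act g^-1%g m1)) -actP.2 mulgV actP.1 => lt2.
by have := mmin m2 Vm2; lia.
Qed.

End Visibility.

(** * The completion *)

Section CompletionSpace.
Variables (M : Type) (U : uniformity M).
Local Notation T := (completion U).

Lemma entourage_small_common u : U u -> entourage (@small_common M U u).
Proof. by move=> Uu; exists u. Qed.

Lemma completion_entourageP (E : set (T * T)) : entourage E ->
  exists2 u, U u & small_common u `<=` E.
Proof. by []. Qed.

Lemma iota_small_common u : U u -> exists2 v, U v & forall x y, v (upair x y) ->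
  small_common u (iota_completion U x, iota_completion U y).
Proof.
move=> Uu; have [v Uv vu] := unif_split2 Uu; have [w Uw wv] := unif_split2 Uv.
exists w => // x y xy; exists [set z | v (upair x z)]; split=> /=.
- by exists v.
- by exists w => // z yz; exact: wv yz.
- by move=> s t xs xt; apply: vu xt; rewrite upairC.
Qed.

(** This is the density of the image of [M], in the stronger form that [xi],
    viewed as a filter on [M], converges to itself. *)
Lemma iota_dense (xi : T) E : entourage E ->
  sval xi [set x | E (xi, iota_completion U x)].
Proof.
move=> /completion_entourageP[u Uu uE]; have [v Uv vu] := unif_split2 Uu.
have [[PF cF] _] := svalP xi; have [A FA Av] := cF v Uv.
apply: (filterS _ FA) => x Ax; apply: uE; exists [set y | v (upair x y)].
split=> /=; [|by exists v|by move=> y z xy xz; apply: vu xz; rewrite upairC].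
by apply: (filterS _ FA) => y; exact: Av.
Qed.

(** The uniform thickenings of the members of a Cauchy filter generate the
    minimal Cauchy filter below it. *)
Lemma min_ucauchy_sub (F : set_system M) : ucauchy U F ->
  exists xi : T, sval xi `<=` F.
Proof.
move=> [PF cF].
pose thick u B : set M := [set y | exists2 x, B x & u (upair x y)].
pose F' : set_system M := [set A | exists u B, [/\ U u, F B & thick u B `<=` A]].
have F'F : F' `<=` F.
  move=> A [u [B [Uu FB BA]]]; apply: filterS FB => x Bx; apply: BA.
  by exists x => //; exact: (unif_refl x Uu).
suff minF' : min_ucauchy U F' by exists (exist _ F' minF').
split; first split.
- split; first by move=> /F'F; exact: filter_not_empty.
  split.
  + by exists setT, setT; split=> //; exact: filterT.
  + move=> A1 A2 [u1 [B1 [U1 FB1 s1]]] [u2 [B2 [U2 FB2 s2]]].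
    exists (u1 `&` u2), (B1 `&` B2); split; [exact: filterI|exact: filterI|].
    by move=> y [x [x1 x2] [xy1 xy2]]; split; [apply: s1|apply: s2]; exists x.
  + move=> A1 A2 A12 [u [B [Uu FB BA]]]; exists u, B; split=> //.
    exact: subset_trans A12.
- move=> u Uu; have [v Uv vu] := unif_split4 Uu; have [B FB Bv] := cF v Uv.
  exists (thick v B); first by exists v, B; split=> // y.
  move=> s t [x Bx xs] [y By yt].
  by apply: vu (unif_refl s Uv) _ (Bv _ _ Bx By) yt; rewrite upairC.
move=> F2 [PF2 cF2] F2F'; apply/seteqP; split=> // A [u [B [Uu FB BA]]].
have [D F2D Du] := cF2 u Uu.
have [x [Bx Dx]] := filter_ex (filterI FB (F'F _ (F2F' _ F2D))).
by apply: filterS F2D => y Dy; apply: BA; exists x => //; exact: Du.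
Qed.

(** The intersection of the two filters is then a Cauchy filter, so that it is
    equal to both by minimality. *)
Lemma small_common_eq (xi eta : T) :
  (forall u, U u -> small_common u (xi, eta)) -> xi = eta.
Proof.
move=> sc; pose F := [set A | sval xi A /\ sval eta A].
have [xc ximin] := svalP xi; have [ec etamin] := svalP eta.
have Pxi := xc.1; have Peta := ec.1.
have cF : ucauchy U F.
  split; last by move=> u /sc[A [/= A1 A2 Au]]; exists A.
  split; first by move=> [/filter_not_empty].
  split; first by split; exact: filterT.
    by move=> A B [A1 A2] [B1 B2]; split; exact: filterI.
  by move=> A B AB [A1 A2]; split; [apply: filterS A1|apply: filterS A2].
apply: completion_inj; rewrite -(ximin F)//; last by move=> A [].
by rewrite -(etamin F)//; move=> A [].
Qed.

Lemma completion_hausdorff : hausdorff_space T.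
Proof.
move=> xi eta clu; apply: small_common_eq => u Uu.
have [v Uv vu] := unif_split2 Uu.
have [zeta [xz ez]] := clu _ _
  (nbhs_entourage xi (entourage_small_common Uv))
  (nbhs_entourage eta (entourage_small_common Uv)).
move: xz ez => /xsectionP[A [/= xA zA Av]] /xsectionP[B [/= eB zB Bv]].
have Pzeta := completion_proper zeta.
have Pxi := completion_proper xi; have Peta := completion_proper eta.
have [z [Az Bz]] := filter_ex (filterI zA zB).
have vu' a b : v (upair a b) -> u (upair a b).
  by move=> ab; apply: vu (unif_refl a Uv) ab.
exists (A `|` B); split=> /=.
- by apply: filterS xA => x; left.
- by apply: filterS eB => x; right.
by move=> x y [Ax|Bx] [Ay|By]; [apply: vu'| | |apply: vu'];
  [exact: Av|apply: (vu _ z); [exact: Av|exact: Bv]|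
   apply: (vu _ z); [exact: Bv|exact: Av]|exact: Bv].
Qed.

(** For an ultrafilter [FF] on the completion, the sets that belong to almost
    all points of the completion form a filter [S] on [M]. Total boundedness
    makes it Cauchy, and [FF] converges to the minimal Cauchy filter below
    [S]. *)
Lemma completion_compact :
  (forall u, U u -> exists2 V, finite_set V &
     forall x, exists2 m, V m & u (upair m x)) ->
  compact [set: T].
Proof.
move=> tb; rewrite compact_ultra => FF UF _.
pose S : set_system M := [set A | FF [set xi : T | sval xi A]].
have cS : ucauchy U S.
  split.
    split.
      move=> S0; have [xi /= xi0] := @filter_ex _ FF _ _ S0.
      have Pxi := completion_proper xi; exact: filter_not_empty xi0.
    split.
    - apply: (@filterS _ FF _ setT) filterT => xi _ /=.
      by have Pxi := completion_proper xi; exact: filterT.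
    - move=> A B SA SB; apply: (@filterS _ FF) (@filterI _ FF _ _ _ SA SB).
      by move=> xi [/= xA xB]; have Pxi := completion_proper xi; exact: filterI.
    - move=> A B AB; apply: (@filterS _ FF) => xi /=.
      by have Pxi := completion_proper xi; exact: filterS.
  move=> u Uu; have [v Uv vu] := unif_split4 Uu.
  have [V fV VP] := tb v Uv.
  pose ball m : set M := [set y | exists2 x, v (upair m x) & v (upair x y)].
  have cover : FF (\bigcup_(m in V) [set xi : T | sval xi (ball m)]).
    apply: filterS filterT => xi _.
    have [[Pxi cxi] _] := svalP xi; have [A xA Av] := cxi v Uv.
    have [x Ax] := filter_ex xA; have [m Vm mx] := VP x.
    by exists m => //=; apply: filterS xA => y Ay; exists x => //; exact: Av.
  have [m Vm Sm] := ultra_finite_bigcup UF fV cover; exists (ball m) => //.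
  move=> s t [x mx xs] [y my yt].
  by apply: vu _ _ my yt; rewrite upairC; [exact: xs|exact: mx].
have [xi xiS] := min_ucauchy_sub cS; exists xi; split=> //.
apply/cvg_entourageP => E /completion_entourageP[u Uu uE].
have [[_ /(_ u Uu)[A xA Au]] _] := svalP xi.
apply: (@filterS _ FF) (xiS A xA) => eta /= etaA; apply: uE.
by exists A.
Qed.

End CompletionSpace.

(** * The action on the completion *)

Section CompletionAct.
Variables (G : groupType) (M : Type) (act : G -> M -> M).
Hypothesis actP : is_action act.
Variables (U : uniformity M) (invU : Defs.invariant act U).
Local Notation T := (completion U).
Local Notation rho := (completion_act actP invU).
Local Notation iota := (iota_completion U).

Lemma completion_act_action : is_action rho.
Proof.
split=> [xi|g h xi]; apply: completion_inj; rewrite /= /fmap/=.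
  by apply/funext => A /=; congr (sval xi _); apply/funext => x /=; rewrite actP.1.
apply/funext => A /=; congr (sval xi _); apply/funext => x /=.
by rewrite actP.2.
Qed.

Lemma completion_act_continuous g : continuous (rho g).
Proof.
move=> xi; apply: (cvg_app_entourageP (rho g) (nbhs_filter xi) _).2.
move=> E /completion_entourageP[u Uu uE].
have /(nbhs_entourage xi) := entourage_small_common (invU g^-1%g Uu).
apply: filterS => eta /xsectionP[A [xA eA Au]]; apply: uE.
exists (act g @` A); split=> /=.
- by apply: (@filterS _ _ (completion_proper xi) _ _ _ xA) => x Ax; exists x.
- by apply: (@filterS _ _ (completion_proper eta) _ _ _ eA) => x Ax; exists x.
move=> _ _ [x Ax <-] [y Ay <-]; have := Au x y Ax Ay.
by rewrite (S2map_act_image actP) /= invgK S2map_upair.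
Qed.

Lemma completion_act_iota g x : rho g (iota x) = iota (act g x).
Proof.
apply: completion_inj => /=; have [_ iota_min] := point_filterP U (act g x).
apply: iota_min.
  by apply: (ucauchy_act actP invU); exact: (point_filterP U x).1.
move=> A [u Uu uA]; exists (S2map (act g) @` u); first exact: invU.
move=> y /= [p up pE]; rewrite -(actP.1 y) -(mulgV g) actP.2; apply: uA => /=.
suff -> : upair x (act g^-1%g y) = p by [].
by rewrite -(S2map_actK actP g p) pE S2map_upair -actP.2 mulVg actP.1.
Qed.

(** If all translates of [xi] and [eta] had a common [u]-small member, then
    intersecting finitely many of these members, moved back, would give the
    two points a common [v]-small member for every [v]. *)
Lemma completion_separated (u : set (S2 M)) (xi eta : T) :
    unif U = generated act u -> xi <> eta ->
  exists g, ~ small_common u (rho g xi, rho g eta).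
Proof.
move=> genU xieta; apply: contrapT => nsep; apply: xieta.
apply: small_common_eq => v; rewrite genU => /generated_base[H fH Hv].
have sep h : exists A, [/\ sval (rho h^-1%g xi) A, sval (rho h^-1%g eta) A &
    forall x y, A x -> A y -> u (upair x y)].
  apply: contrapT => ns; apply: nsep; exists h^-1%g => sc; apply: ns.
  by case: sc => A; exists A.
have [A AP] := choice sep.
exists (\bigcap_(h in H) [set x | A h (act h^-1%g x)]); split=> /=.
- have Pxi := completion_proper xi; apply: filter_finite_bigcap => // h _.
  by have [] := AP h.
- have Peta := completion_proper eta; apply: filter_finite_bigcap => // h _.
  by have [] := AP h.
move=> x y Ax Ay; apply: Hv; apply/(translates_capE actP) => h Hh.
by have [_ _] := AP h; apply; [exact: Ax|exact: Ay].
Qed.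

(** Otherwise [xi] has a neighbourhood that avoids each of the finitely many
    orbits, which contradicts density. *)
Lemma boundary_orbit_limit (V : set M) (xi : T) : finite_set V ->
    (forall x, exists2 m, V m & exists g, x = act g m) ->
  exists m, forall E, entourage E -> exists g, E (xi, rho g (iota m)).
Proof.
move=> fV VP; have Pxi := completion_proper xi; apply: contrapT => nex.
have nE m : exists E, entourage E /\ forall g, ~ E (xi, rho g (iota m)).
  apply: contrapT => nE; apply: nex; exists m => E entE.
  by apply: contrapT => ng; apply: nE; exists E; split=> // g gE; apply: ng; exists g.
have [E EP] := choice nE.
have : sval xi (\bigcap_(m in V) [set x | E m (xi, iota x)]).
  by apply: filter_finite_bigcap => // m _; apply: iota_dense; exact: (EP m).1.
move=> /filter_ex[x xE]; have [m Vm [g xg]] := VP x.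
by apply: ((EP m).2 g); rewrite completion_act_iota -xg; exact: xE.
Qed.

End CompletionAct.

(** * Entourages, subsets of fixed size and closed subsets *)

Section Entourages.
Variable T : uniformType.

Lemma hausdorff_entourage : hausdorff_space T ->
  forall s t : T, s <> t -> exists2 E, entourage E & ~ E (s, t).
Proof.
move=> hT s t st; apply: contrapT => nE; apply: st; apply: hT => A B.
move=> /nbhsP[E entE EA] tB; exists t; split; last exact: nbhs_singleton.
by apply: EA; apply/xsectionP; apply: contrapT => nst; apply: nE; exists E.
Qed.

Lemma entourage_chain3 (E : set (T * T)) : entourage E ->
  exists2 D : set (T * T), entourage D & (forall a b, D (a, b) -> D (b, a)) /\
    forall a b c d, D (a, b) -> D (b, c) -> D (c, d) -> E (a, d).
Proof.
move=> entE; pose E2 := split_ent E; pose E4 := split_ent E2.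
have ent2 : entourage E2 by exact: entourage_split_ent.
have ent4 : entourage E4 by exact: entourage_split_ent.
exists (E4 `&` E4^-1)%relation; first exact: entourage_invI.
split=> [a b []//|a b c d [ab _] [bc _] [cd _]].
apply: (entourage_split c entE); first exact: entourage_split ab bc.
by apply: (entourage_split d ent2) => //; exact: entourage_refl.
Qed.

(** Two different points stay separated by a fixed entourage when both of them
    move a little. *)
Lemma not_entourage_interior (s t : T) : hausdorff_space T -> s <> t ->
  exists2 E : set (T * T), entourage E & (~` E)° (s, t).
Proof.
move=> hT /(hausdorff_entourage hT)[E entE nE].
have [D entD [Dsym DE]] := entourage_chain3 entE.
exists D => //; exists (xsection D s, xsection D t).
  by split; exact: nbhs_entourage.
move=> [s' t'] [/= /xsectionP ss /xsectionP tt] st; apply: nE.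
by apply: DE ss st _; exact: Dsym.
Qed.
End Entourages.

Section ThetaSpace.
Variables (n : nat) (T : topologicalType).

(** The quotient map from injective tuples to [n]-element subsets is onto. *)
Lemma Theta_conf (A : Theta n T) : exists x : conf n T, conf_set x = A.
Proof.
case: A => A cA.
have /card_set_bijP[f [fI finj fsurj]] := cA.
have aP (i : 'I_n) : exists a, A a /\ f a = i.
  by have [a Aa <-] := fsurj i (ltn_ord i); exists a.
have [a aA] := choice aP.
have ainj : injective a.
  by move=> i j ij; apply: ord_inj; rewrite -(aA i).2 -(aA j).2 ij.
have aE : range a = A.
  apply/seteqP; split=> [_ [i _ <-]|t At]; first exact: (aA i).1.
  have lt := fI t At; exists (Ordinal lt) => //=.
  by apply: finj; [exact/mem_set/(aA _).1|exact/mem_set|exact: (aA _).2].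
exists (exist _ (a : prod_topology (fun=> T)) (mem_set ainj)).
rewrite /conf_set; move: (conf_set_subproof _); rewrite /= aE => cA'.
by congr exist; exact: Prop_irrelevance.
Qed.

Lemma continuous_conf_set : continuous (@conf_set n T).
Proof. by apply/continuousP => A; apply. Qed.

Lemma continuous_conf_coord (i j : 'I_n) :
  continuous (fun x : conf n T => (val x i, val x j)).
Proof.
move=> x.
have c k : val y k @[y --> x] --> val x k.
  apply: (@continuous_comp _ _ _
    (val : conf n T -> prod_topology (fun=> T)) (fun p => p k)).
    exact: initial_continuous.
  exact: (@proj_continuous _ (fun=> T)).
apply: (cvg_pair (F := nbhs x) (G := nbhs (val x i)) (H := nbhs (val x j))).
  exact: c.
exact: c.
Qed.

Lemma open_Theta_pairs (O : set (T * T)) : open O ->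
  open [set A : Theta n T |
    forall s t, sval A s -> sval A t -> s <> t -> O (s, t)].
Proof.
move=> oO.
suff : open [set x : conf n T | forall i j, i <> j -> O (val x i, val x j)].
  congr (open _); apply/seteqP; split=> x /= xO.
    move=> s t [i _ <-] [j _ <-] st; apply: xO => ij; apply: st.
    by rewrite ij.
  move=> i j ij; apply: xO; [by exists i|by exists j|move=> eq; apply: ij].
  by have /set_mem := valP x; exact.
rewrite openE => x xO.
have near_ij i j : \forall y \near x, i <> j -> O (val y i, val y j).
  have [<-|ij] := pselect (i = j); first by apply: filterE.
  have : nbhs x ((fun x : conf n T => (val x i, val x j)) @^-1` O).
    apply: continuous_conf_coord; rewrite nbhsE; exists O => //; split=> //.
    exact: xO.
  by apply: filterS.
exact: (filter_forall _ (fun i => filter_forall _ (near_ij i))).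
Qed.

End ThetaSpace.

(** The subset is the image of the set of ordered pairs outside [O], which is
    closed in the compact square and consists of pairs of different points. *)
Lemma compact_separated_pairs (T : topologicalType) (O : set (T * T)) :
    compact [set: T] -> open O -> diagonal `<=` O ->
  compact [set A : Theta 2 T |
    exists s t, [/\ sval A s, sval A t & ~ O (s, t)]].
Proof.
move=> cT oO dO.
pose P := prod_topology (fun _ : 'I_2 => T).
(* Both orders of the coordinates occur, since [O] need not be symmetric. *)
pose L : set P := [set p | exists i j, ~ O (p i, p j)].
have cL : compact L.
  apply: (@subclosed_compact P L setT) => //.
    have -> : L = \bigcup_i \bigcup_j ~` ((fun p : P => (p i, p j)) @^-1` O).
      apply/seteqP; split=> [p [i [j nO]]|p [i _ [j _ nO]]]; last by exists i, j.
      by exists i => //; exists j.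
    apply: closed_bigcup; first exact: finite_finset.
    move=> i _; apply: closed_bigcup; first exact: finite_finset.
    move=> j _; apply: open_closedC; apply: open_comp => // p _.
    apply: (cvg_pair (F := nbhs p) (G := nbhs (p i)) (H := nbhs (p j))).
      exact: (@proj_continuous _ (fun=> T)).
    exact: (@proj_continuous _ (fun=> T)).
  have := @tychonoff 'I_2 (fun=> T) (fun=> setT) (fun=> cT).
  by congr compact; apply/seteqP.
have Linj p : L p -> injective p.
  move=> [i [j nO]].
  have pij : p i <> p j by move=> eq; apply: nO; apply: dO; exact/diagonalP.
  have ij : i <> j :> nat by move=> /ord_inj eq; apply: pij; rewrite eq.
  have two k : k = i \/ k = j.
    suff [eq|eq] : k = i :> nat \/ k = j :> nat.
      by left; exact: ord_inj.
      by right; exact: ord_inj.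
    by have := ltn_ord i; have := ltn_ord j; have := ltn_ord k; lia.
  by move=> k l; have [->|->] := two k; have [->|->] := two l => // eq;
    case: pij; rewrite eq.
have cL' : compact ((val : conf 2 T -> P) @^-1` L).
  move=> F PF FL.
  have FL' : (val @ F) L by apply: filterS FL.
  have [p [Lp clp]] := cL _ _ FL'.
  have pinj := Linj p Lp; exists (exist _ p (mem_set pinj)); split=> //.
  move=> B N FB [_ [[W oW <-] Wp] WN].
  have FB' : ((val : conf 2 T -> P) @ F) ((val : conf 2 T -> P) @` B).
    by apply: (@filterS _ F _ _ _ _ FB) => b Bb; exists b.
  have nW : nbhs p W by rewrite nbhsE; exists W.
  have [q [[b Bb <-] Wb]] := clp _ _ FB' nW.
  by exists b; split=> //; apply: WN.
have -> : [set A : Theta 2 T | exists s t, [/\ sval A s, sval A t & ~ O (s, t)]]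
   = @conf_set 2 T @` ((val : conf 2 T -> P) @^-1` L).
  apply/seteqP; split=> [A [s [t [As At nO]]]|_ [x [i [j nO]] <-]]; last first.
    by exists (val x i), (val x j); split=> //; eexists.
  have [x xA] := Theta_conf A; rewrite -xA in As At *.
  by case: As At nO => i _ <- [j _ <-] nO; exists x => //; exists i, j.
apply: continuous_compact => //.
apply: continuous_subspaceT; exact: continuous_conf_set.
Qed.

(** The neighbourhoods in the topology generated by a subbase, in a form that
    keeps the encoding of finite intersections out of later proofs. *)
Lemma vietoris_nbhs (X : topologicalType) (C : closed_subset X)
    (B : set (closed_subset X)) : nbhs C B ->
  exists2 S : set (set (closed_subset X)), finite_set S &
    (forall V, S V -> vietoris_subbase V /\ V C) /\
    forall D, (forall V, S V -> V D) -> B D.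
Proof.
rewrite nbhsE => -[W [[D D_finI <-] [Z DZ ZC]] WB].
have [S Ssub eZ] := D_finI Z DZ.
exists [set` S]; first exact: finite_fset.
split=> [V VS|D' D'S].
  split; first exact: set_mem (Ssub V VS).
  by move: ZC; rewrite -eZ => /(_ V VS).
by apply: WB; exists Z => //; rewrite -eZ.
Qed.

(** * Dynamics on a compact Hausdorff space *)

Section Dynamics.
Variables (G : groupType) (T : uniformType) (rho : G -> T -> T).
Hypothesis rhoP : is_action rho.
Hypotheses (cT : compact [set: T]) (hT : hausdorff_space T).

Lemma action_inj g : injective (rho g).
Proof.
by move=> s t st; rewrite -(rhoP.1 s) -(rhoP.1 t) -(mulVg g) !rhoP.2 st.
Qed.

Lemma diagonal_interior (E : set (T * T)) : entourage E -> diagonal `<=` E°.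
Proof.
move=> entE [s _] /diagonalP <-; have [D entD [Dsym DE]] := entourage_chain3 entE.
exists (xsection D s, xsection D s); first by split; exact: nbhs_entourage.
move=> [s' t'] [/= /xsectionP ss /xsectionP st].
by apply: DE (Dsym _ _ ss) st _; exact: entourage_refl.
Qed.

Lemma expansive_cocompact (E : set (T * T)) : entourage E ->
    (forall s t, s <> t -> exists g, ~ E (rho g s, rho g t)) ->
  cocompact_on_pairs rho.
Proof.
move=> entE sep.
exists [set A : Theta 2 T | exists s t, [/\ sval A s, sval A t & ~ E° (s, t)]].
  by apply: compact_separated_pairs; [|exact: open_interior|exact: diagonal_interior].
apply/seteqP; split=> // A _.
have [x xA] := Theta_conf A; have xinj : injective (val x) by have /set_mem := valP x.
have [g nE] : exists g, ~ E (rho g (val x ord0), rho g (val x ord_max)).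
  by apply: sep => /xinj.
pose y : prod_topology (fun _ : 'I_2 => T) := fun i => rho g (val x i).
have yinj : injective y by move=> i j /action_inj /xinj.
exists g^-1%g => //; exists (conf_set (exist _ y (mem_set yinj))); last first.
  rewrite -xA /=; apply/seteqP; split=> [_ [i _ <-]|_ [_ [i _ <-] <-]].
    exists (y i); first by exists i.
    by rewrite /y -rhoP.2 mulVg rhoP.1.
  by exists i => //; rewrite /= /y -rhoP.2 mulVg rhoP.1.
exists (y ord0), (y ord_max); split; [by exists ord0|by exists ord_max|].
by move=> /interior_subset.
Qed.

Variables (M : Type) (iota : M -> T).
Hypothesis iota_perspective : forall E x y, entourage E ->
  finite_set [set g | ~ E (rho g (iota x), rho g (iota y))].
(* A point that is not close to [g^-1 V] is mapped by [g] close to [g V]; by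
   perspectivity both finite sets are small for all but finitely many [g]. *)
Hypothesis two_sided : forall E, entourage E -> exists2 V, finite_set V &
  forall g t, exists2 m, V m &
    E (t, rho g^-1%g (iota m)) \/ E (rho g t, rho g (iota m)).

(** Near each subset in [K] the points of a subset are separated by a fixed
    entourage; by compactness one entourage serves all of [K]. *)
Lemma separated_compact n (K : set (Theta n T)) : compact K ->
  exists2 E : set (T * T), entourage E &
    forall A, K A -> forall s t, sval A s -> sval A t -> E (s, t) -> s = t.
Proof.
move=> /compact_near_coveringP cK.
pose sep (E : set (T * T)) (A : Theta n T) :=
  forall s t, sval A s -> sval A t -> E (s, t) -> s = t.
(* The filter of the statements that hold for all small enough relations. *)
pose small : set_system (set (T * T)) :=
  filter_from entourage (fun E => [set E' | E' `<=` E]).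
have FS : Filter small.
  apply: filter_from_filter; first by exists setT; exact: filterT.
  move=> E1 E2 ent1 ent2; exists (E1 `&` E2); first exact: filterI.
  by move=> E; rewrite /= subsetI.
suff near_sep A : K A -> \forall B \near A & E \near small, sep E B.
  have [E entE KE] := cK _ small sep FS near_sep.
  by exists E => // A KA; exact: (KE E (@subset_refl _ E) A KA).
move=> KA.
  have fA : finite_set (sval A) by exists n; exact: (svalP A).
  have sepE (p : T * T) : exists E : set (T * T), entourage E /\
      (p.1 <> p.2 -> (~` E)° p).
    have [eq|ne] := pselect (p.1 = p.2).
      by exists setT; split=> //; exact: filterT.
    by case: p ne => s t /= /(not_entourage_interior hT)[E entE nE]; exists E.
  have [E EP] := choice sepE.
  pose E0 := \bigcap_(p in sval A `*` sval A) E p.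
  have entE0 : entourage E0.
    apply: filter_finite_bigcap; first exact: finite_setX.
    by move=> p _; exact: (EP p).1.
  pose W := [set B : Theta n T |
    forall s t, sval B s -> sval B t -> s <> t -> (~` E0)° (s, t)].
  have nW : nbhs A W.
    rewrite nbhsE; exists W => //; split.
      by apply: open_Theta_pairs; exact: open_interior.
    move=> s t As At st; apply: interiorS ((EP (s, t)).2 st).
    by apply: subsetC; apply: bigcap_inf.
  exists (W, [set E' | E' `<=` E0]); first by split=> //; exists E0.
  move=> [B E'] [/= WB E'E0] s t Bs Bt Est; apply: contrapT => st.
  by have /interior_subset := WB s t Bs Bt st; apply; exact: E'E0.
Qed.

(** Choose [g] outside the finite set of elements for which [g V] or [g^-1 V]
    is not small. Each of the three points of [A] is close to [g^-1 V] or has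
    its image close to [g V]. Two of the points are in the same case, so they
    are close to each other or their images are; but [A] and its image [B] are
    both in [K], whose members have separated points. *)
Lemma two_sided_proper : proper_on_triples rho.
Proof.
move=> K /separated_compact[E entE sepE].
have [D entD [Dsym DE]] := entourage_chain3 entE.
have [V fV VP] := two_sided entD.
pose bad m m' := [set g | ~ D (rho g (iota m), rho g (iota m'))].
have fbad m m' : finite_set (bad m m') by exact: iota_perspective.
apply: (@sub_finite_set _ _ (\bigcup_(m in V) \bigcup_(m' in V)
    (bad m m' `|` (fun g => g^-1%g) @` bad m m'))); last first.
  apply: bigcup_finite => // m _; apply: bigcup_finite => // m' _.
  by rewrite finite_setU; split=> //; exact: finite_image.
move=> g [B [[A KA BA] KB]]; apply: contrapT => good.
have closeV h m m' : V m -> V m' -> h = g \/ h = g^-1%g ->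
    D (rho h (iota m), rho h (iota m')).
  move=> Vm Vm' hg; apply: contrapT => nD; apply: good; exists m => //.
  exists m' => //; case: hg => hg; first by left; rewrite -hg.
  by right; exists h => //; rewrite hg invgK.
pose left t := exists2 m, V m & D (t, rho g^-1%g (iota m)).
pose right t := exists2 m, V m & D (rho g t, rho g (iota m)).
have sides t : left t \/ right t.
  by have [m Vm [?|?]] := VP g t; [left|right]; exists m.
have left1 s t : sval A s -> sval A t -> left s -> left t -> s = t.
  move=> As At [m Vm sm] [m' Vm' tm]; apply: (sepE A) => //.
  by apply: DE sm _ (Dsym _ _ tm); apply: closeV => //; right.
have right1 s t : sval A s -> sval A t -> right s -> right t -> s = t.
  move=> As At [m Vm sm] [m' Vm' tm]; apply: (@action_inj g); apply: (sepE B) => //.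
  - by rewrite BA; exists s.
  - by rewrite BA; exists t.
  - by apply: DE sm _ (Dsym _ _ tm); apply: closeV => //; left.
have [x xA] := Theta_conf A; have xinj : injective (val x) by have /set_mem := valP x.
have xP i : sval A (val x i) by rewrite -xA; exists i.
have neq i j : i != j -> val x i <> val x j by move=> /eqP ij /xinj.
pose a0 : 'I_3 := ord0; pose a1 : 'I_3 := lift ord0 ord0; pose a2 : 'I_3 := ord_max.
have [s0|s0] := sides (val x a0); have [s1|s1] := sides (val x a1);
  have [s2|s2] := sides (val x a2).
- exact: (neq a0 a1) (left1 _ _ _ _ s0 s1).
- exact: (neq a0 a1) (left1 _ _ _ _ s0 s1).
- exact: (neq a0 a2) (left1 _ _ _ _ s0 s2).
- exact: (neq a1 a2) (right1 _ _ _ _ s1 s2).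
- exact: (neq a1 a2) (left1 _ _ _ _ s1 s2).
- exact: (neq a0 a2) (right1 _ _ _ _ s0 s2).
- exact: (neq a0 a1) (right1 _ _ _ _ s0 s1).
- exact: (neq a0 a1) (right1 _ _ _ _ s0 s1).
Qed.

Hypothesis iota_dense : forall E t, entourage E -> exists x, E (t, iota x).
Hypothesis rho_continuous : forall g, continuous (rho g).

Lemma closed_graph g : closed (graph rho g).
Proof.
move=> [s t] cl /=; apply: contrapT => ts.
have [E entE nE] := hausdorff_entourage hT ts.
have [D entD [Dsym DE]] := entourage_chain3 entE.
have nbs : nbhs s (rho g @^-1` (xsection D (rho g s))).
  by apply: rho_continuous; exact: nbhs_entourage.
have nb : nbhs (s, t) ((rho g @^-1` (xsection D (rho g s))) `*` xsection D t).
  by exists (rho g @^-1` (xsection D (rho g s)), xsection D t) => //; split=> //;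
    exact: nbhs_entourage.
have [[s' t'] [/= ts' [/= /xsectionP ss /xsectionP tt]]] := cl _ nb.
have {}ts' : t' = rho g s' := ts'; rewrite ts' in tt.
by apply: nE; apply: DE tt (Dsym _ _ ss) _; exact: entourage_refl.
Qed.

Lemma closed_cross r a : closed (@cross T r a).
Proof.
have closed1 (s : T) : closed [set s].
  exact: (accessible_closed_set1 (hausdorff_accessible hT)).
have -> : cross r a = fst @^-1` [set r] `|` snd @^-1` [set a].
  by apply/seteqP; split=> -[s t] /= [[]|[]]; by [left|right].
by apply: closedU; apply: preimage_closed => // p _; [exact: cvg_fst|exact: cvg_snd].
Qed.

Section LimitPoint.
Variables (a : T) (m0 : M).
Hypothesis a_orbit : forall g, rho g (iota m0) <> a.
Hypothesis a_limit : forall E, entourage E -> exists g, E (a, rho g (iota m0)).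

(** The ultrafilter contains no finite set, because [a] is not in the orbit of
    [m0]. By perspectivity the orbits of all points of [M] therefore have the
    same limit along it, for [g] as well as for [g^-1]; compactness provides the
    limit [r]. *)
Lemma attracting_ultrafilter : exists F : set_system G, [/\ UltraFilter F,
  forall E x, entourage E -> F [set g | E (a, rho g (iota x))] &
  exists r, forall E x, entourage E -> F [set g | E (r, rho g^-1%g (iota x))]].
Proof.
pose F0 := filter_from entourage (fun E => [set g | E (a, rho g (iota m0))]).
have PF0 : ProperFilter F0.
  apply: filter_from_proper; last by move=> E entE; exact: a_limit.
  apply: filter_from_filter; first by exists setT; exact: filterT.
  by move=> E1 E2 ent1 ent2; exists (E1 `&` E2) => //; exact: filterI.
have [F [UF F0F]] := ultraFilterLemma PF0.
have FN1 h : F [set g | g <> h].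
  apply: F0F; have [E entE nE] := hausdorff_entourage hT (nesym (@a_orbit h)).
  by exists E => // g /= Eg gh; apply: nE; rewrite -gh.
have FC Q : finite_set Q -> F (~` Q).
  move=> fQ; have FQ : F (\bigcap_(h in Q) [set g | g <> h]).
    by apply: filter_finite_bigcap => // h _; exact: FN1.
  by apply: filterS FQ => g ng Qg; exact: (ng g Qg).
have a_lim E x : entourage E -> F [set g | E (a, rho g (iota x))].
  move=> entE; have [D entD [Dsym DE]] := entourage_chain3 entE.
  have FD : F [set g | D (a, rho g (iota m0))] by apply: F0F; exists D.
  apply: filterS (filterI FD (FC _ (iota_perspective m0 x entD))).
  move=> g [/= ag /contrapT gx]; apply: DE ag gx _; exact: entourage_refl.
exists F; split=> //.
pose back g := rho g^-1%g (iota m0).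
have [r [_ clr]] := cT (fmap_proper_filter back _) (filterT : (back @ F) setT).
exists r => E x entE; have [D entD [Dsym DE]] := entourage_chain3 entE.
have FD : F [set g | D (r, back g)].
  have [//|nD] := in_ultra_setVsetC [set g | D (r, back g)] UF.
  have FnD : (back @ F) (back @` (~` [set g | D (r, back g)])).
    by apply: (@filterS _ F _ _ _ _ nD) => g gE; exists g.
  have [_ [[g gE <-] /xsectionP rs]] := clr _ _ FnD (nbhs_entourage r entD).
  by case: gE.
have fQ : finite_set ((fun g => g^-1%g) @` [set g |
    ~ D (rho g (iota m0), rho g (iota x))]).
  by apply: finite_image; exact: iota_perspective.
apply: filterS (filterI FD (FC _ fQ)) => g [/= rg ng].
apply: DE rg _ (entourage_refl _ entD); apply: contrapT => nD; apply: ng.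
by exists g^-1%g => //; rewrite invgK.
Qed.

Variables (F : set_system G) (r : T).
Hypothesis UF : UltraFilter F.
Hypothesis F_a : forall E x, entourage E -> F [set g | E (a, rho g (iota x))].
Hypothesis F_r : forall E x, entourage E ->
  F [set g | E (r, rho g^-1%g (iota x))].

(** If almost all graphs had a point [(t, g t)] outside [O], these points would
    accumulate at some [(b, c)] outside [O], with [b <> r] and [c <> a]. But
    [t] is close to [g^-1 V], hence to [r], or [g t] is close to [g V], hence to
    [a]. *)
Lemma graph_near_cross (O : set (T * T)) : open O -> cross r a `<=` O ->
  F [set g | graph rho g `<=` O].
Proof.
move=> oO crossO.
have [//|nO] := in_ultra_setVsetC [set g | graph rho g `<=` O] UF.
have tP g : exists t, ~ (graph rho g `<=` O) -> ~ O (t, rho g t).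
  have [?|nsub] := pselect (graph rho g `<=` O); first by exists a.
  apply: contrapT => nex; apply: nsub => -[s t] ts.
  rewrite (ts : t = rho g s); apply: contrapT => nOs.
  by apply: nex; exists s.
have [t {}tP] := choice tP.
pose p g := (t g, rho g (t g)).
have cTT : compact [set: T * T] by rewrite -setXTT; exact: compact_setX.
have [[b c] [_ clbc]] := cTT _ (fmap_proper_filter p _) (filterT : (p @ F) setT).
have nObc : ~ O (b, c).
  move=> Obc; have nbO : nbhs (b, c) O by rewrite nbhsE; exists O.
  have FnO : (p @ F) (~` O) by apply: (@filterS _ F _ _ _ _ nO) => g /= /tP.
  by have [q [nq q']] := clbc _ _ FnO nbO.
have br : b <> r by move=> eq; apply: nObc; apply: crossO; left.
have ca : c <> a by move=> eq; apply: nObc; apply: crossO; right.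
have [E1 ent1 nE1] := hausdorff_entourage hT br.
have [E2 ent2 nE2] := hausdorff_entourage hT ca.
have [D entD [Dsym DE]] := entourage_chain3 (filterI ent1 ent2).
have [V fV VP] := two_sided entD.
have Fr : F (\bigcap_(m in V) [set g | D (r, rho g^-1%g (iota m))]).
  by apply: filter_finite_bigcap => // m _; exact: F_r.
have Fa : F (\bigcap_(m in V) [set g | D (a, rho g (iota m))]).
  by apply: filter_finite_bigcap => // m _; exact: F_a.
have Fp : (p @ F) (p @` ((\bigcap_(m in V) [set g | D (r, rho g^-1%g (iota m))])
    `&` (\bigcap_(m in V) [set g | D (a, rho g (iota m))]))).
  by apply: (@filterS _ F _ _ _ _ (filterI Fr Fa)) => g gV; exists g.
have nb : nbhs (b, c) (xsection D b `*` xsection D c).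
  by exists (xsection D b, xsection D c) => //; split; exact: nbhs_entourage.
have [_ [[g [gr ga] <-] [/= /xsectionP bt /xsectionP ct]]] := clbc _ _ Fp nb.
have [m Vm [tm|tm]] := VP g (t g).
  by case: nE1; have [] := DE _ _ _ _ bt tm (Dsym _ _ (gr m Vm)).
by case: nE2; have [] := DE _ _ _ _ ct tm (Dsym _ _ (ga m Vm)).
Qed.

(** By density the point of the cross in [O] may be replaced with [(r, iota x)]
    or [(iota x, a)], and these are limits of the points
    [(g^-1 (iota x), iota x)] and [(iota x, g (iota x))] of the graphs. *)
Lemma graph_meets_near_cross (O : set (T * T)) : open O ->
  cross r a `&` O !=set0 -> F [set g | graph rho g `&` O !=set0].
Proof.
move=> oO [[s t] [st Ost]].
have /= [[A B] [/= sA tB] ABO] : nbhs (s, t) O by rewrite nbhsE; exists O.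
have [E entE EA] := (nbhsP _ _).1 sA; have [E' entE' EB] := (nbhsP _ _).1 tB.
case: st => [[/= sr _]|[_ /= ta]].
  have [x tx] := iota_dense t entE'.
  apply: filterS (F_r x entE) => g /= gr.
  exists (rho g^-1%g (iota x), iota x); split=> /=.
    by rewrite /graph /= -rhoP.2 mulgV rhoP.1.
  apply: ABO; split=> /=; first by apply: EA; apply/xsectionP; rewrite sr.
  by apply: EB; apply/xsectionP.
have [x sx] := iota_dense s entE.
apply: filterS (F_a x entE') => g /= ga.
exists (iota x, rho g (iota x)); split=> //=.
apply: ABO; split=> /=; first by apply: EA; apply/xsectionP.
by apply: EB; apply/xsectionP; rewrite ta.
Qed.

End LimitPoint.

(** The two preceding lemmas deal with the two kinds of subbasic open sets of
    the Vietoris topology. *)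
Lemma orbit_limit_point a m0 : (forall g, rho g (iota m0) <> a) ->
  (forall E, entourage E -> exists g, E (a, rho g (iota m0))) ->
  Defs.limit_point rho a.
Proof.
move=> a_orbit a_limit.
have [F [UF F_a [r F_r]]] := attracting_ultrafilter a_orbit a_limit.
exists r; exists (exist _ (cross r a) (@closed_cross r a)) => //.
move=> B /vietoris_nbhs[S fS [S_sub SB]].
pose gr g : closed_subset (T * T)%type := exist _ (graph rho g) (@closed_graph g).
have FS : F (\bigcap_(V in S) [set g | V (gr g)]).
  apply: filter_finite_bigcap => // V SV.
  have [[O oO [VE|VE]] CV] := S_sub V SV; rewrite VE in CV *.
    exact: (graph_near_cross UF F_a F_r oO CV).
  exact: (graph_meets_near_cross UF F_a F_r oO CV).
have [g gS] := filter_ex FS; exists (gr g); split; first by exists g.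
by apply: SB => V SV; exact: gS.
Qed.

End Dynamics.

(** * The action on the completion is relatively hyperbolic *)

Theorem proposition4p2p2 (G : groupType) (M : Type) (act : G -> M -> M)
    (actP : is_action act) (Mconn : connected_gset act)
    (U : uniformity M) (RHU : relatively_hyperbolic act U) :
  RH32 (completion_act actP (relatively_hyperbolic_invariant actP RHU)).
Proof.
set invU := relatively_hyperbolic_invariant actP RHU.
have [[u [u_div u_persp genU]] [xi [eta [bxi beta xieta]]]] := RHU.
have [E [_ Eact Efin conn]] := Mconn.
set rho := completion_act actP invU.
have rhoP : is_action rho by exact: completion_act_action.
have rho_iota g x : rho g (iota_completion U x) = iota_completion U (act g x).
  exact: completion_act_iota.
have Uu : U u by rewrite genU; exact: generated_self.
have Pxi := completion_proper xi.
have [o _] := filter_ex (filterT : sval xi setT).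
have hT := @completion_hausdorff M U.
have vis v (Uv : U v) :=
  visibility_two_sided actP u_div u_persp genU Eact Efin conn o Uv.
have cT : compact [set: completion U].
  apply: completion_compact => v /vis[V fV VP]; exists V => // x.
  have [m Vm vm] := VP 1%g x; exists m => //.
  by move: vm; rewrite invg1 !actP.1 => -[].
have persp D x y : entourage D ->
    finite_set [set g |
      ~ D (rho g (iota_completion U x), rho g (iota_completion U y))].
  move=> /completion_entourageP[v Uv vD]; have [w Uw wv] := iota_small_common Uv.
  apply: sub_finite_set (unif_perspective actP u_persp genU x y Uw) => g /= nD wg.
  by apply: nD; rewrite !rho_iota; apply: vD; exact: wv.
have two_sided D : entourage D -> exists2 V, finite_set V & forall g t,
    exists2 m, V m & D (t, rho g^-1%g (iota_completion U m)) \/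
                     D (rho g t, rho g (iota_completion U m)).
  move=> /entourage_chain3[D' entD' [Dsym DD]].
  have [v Uv vD] := completion_entourageP entD'.
  have [w Uw wv] := iota_small_common Uv; have [V fV VP] := vis w Uw.
  exists V => // g t; have Pt := completion_proper t.
  have near_gt : sval t [set x | D' (rho g t, iota_completion U (act g x))].
    exact: (iota_dense (rho g t) entD').
  have [x [tx gtx]] := filter_ex (filterI (iota_dense t entD') near_gt).
  have [m Vm close] := VP g x; exists m => //; rewrite !rho_iota.
  case: close => /wv/vD/Dsym close; [left|right].
    by apply: DD tx close _; exact: entourage_refl.
  by apply: DD gtx close _; exact: entourage_refl.
have dense D t : entourage D -> exists x, D (t, iota_completion U x).
  have Pt := completion_proper t.
  by move=> entD; have [x tx] := filter_ex (iota_dense t entD); exists x.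
have cont : forall g, continuous (rho g) by exact: completion_act_continuous.
(* If [M] had a single point, the completion would by density be reduced to
   its image, and the boundary would be empty. *)
have [p op] : exists p, o <> p.
  apply: contrapT => nex; apply: bxi; exists o => //; apply: contrapT => oxi.
  have [D entD nD] := hausdorff_entourage hT (nesym oxi); apply: nD.
  have [x] := dense D xi entD; suff -> : x = o by [].
  by apply: contrapT => xo; apply: nex; exists x; exact: nesym.
have [V fV VP] := vertex_orbits actP Efin conn op.
have lim z : boundary z -> Defs.limit_point rho z.
  move=> bz; have [m mP] := boundary_orbit_limit actP invU z fV VP.
  apply: (orbit_limit_point rhoP cT hT persp two_sided dense cont (m0 := m)) => //.
  by move=> g gz; apply: bz; exists (act g m) => //; rewrite -rho_iota.
split.
- by [].
- by [].
- exact: (two_sided_proper rhoP hT persp two_sided).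
- apply: (expansive_cocompact rhoP cT (entourage_small_common Uu)) => s t st.
  exact: completion_separated.
- by exists xi, eta; split; [exact: lim|exact: lim|].
Qed.
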